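(* Let $\mu$ be an invariant probability measure for the Markov kernel $P$ on $\mathcal{X}$ induced by the dynamics $x_{k+1}=f(x_k)+n_k$. Let $\hat f:\mathcal{X}\to\mathcal{X}$ be a fixed predictor, $s_{\hat f}:\mathcal{X}\times\mathcal{X}\to\mathbb{R}_{\ge 0}$ a fixed score function, $N\ge 1$ an integer and $\alpha\in(0,1)$. Assume that the calibration states $X_1^{\mathrm{cal}},\dots,X_N^{\mathrm{cal}}$ and the initial state $x_0$ are sampled independently from $\mu$, that the calibration successors satisfy $X_{i,+}^{\mathrm{cal}}\sim P(X_i^{\mathrm{cal}},\cdot)$, and that the trajectory $(x_k)_{k\ge 0}$ started at $x_0$ evolves according to $P$; the calibration pairs $(X_i^{\mathrm{cal}},X_{i,+}^{\mathrm{cal}})$, $i=1,\dots,N$, are i.i.d. and independent of the trajectory. Let $\hat q_{1-\alpha}$ be the conformal quantile computed from the calibration scores $S_i^{\mathrm{cal}}=s_{\hat f}(X_i^{\mathrm{cal}},X_{i,+}^{\mathrm{cal}})$, $i=1,\dots,N$, and let $S_k:=s_{\hat f}(x_k,x_{k+1})$. Then, for every fixed time step $k\ge 0$, $$\mathbb{P}\bigl(S_k\le \hat q_{1-\alpha}\bigr)\ge 1-\alpha .$$ Equivalently, $$\mathbb{P}\bigl(x_{k+1}\in\mathcal{C}^{(1)}_{\alpha}(x_k)\bigr)\ge 1-\alpha .$$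
   Context: Setting: $\mathcal{X}\subseteq\mathbb{R}^d$ is a (Borel) state space with Borel $\sigma$-algebra $\mathcal{B}(\mathcal{X})$. The stochastic dynamical system is $x_{k+1}=f(x_k)+n_k$, where $f:\mathcal{X}\to\mathcal{X}$ and $(n_k)$ is a noise sequence that, given the current state, is independent of the past, so that $(x_k)$ is a time-homogeneous $\mathcal{X}$-valued Markov chain with transition kernel $$P(x,A)=\mathbb{P}(f(x)+n_k\in A\mid x_k=x),\qquad A\in\mathcal{B}(\mathcal{X}),$$ i.e. the conditional law of $x_{k+1}$ given $(x_0,\dots,x_k)$ is $P(x_k,\cdot)$ for every $k\ge 0$. A probability measure $\mu$ on $\mathcal{X}$ is invariant for $P$ if $\mu(A)=\int_{\mathcal{X}}P(x,A)\,\mu(dx)$ for all $A\in\mathcal{B}(\mathcal{X})$. The predictor $\hat f$ and the score function $s_{\hat f}$ are measurable and fixed (the calibration data are not used to construct them). Conformal quantile: $\hat q_{1-\alpha}$ is the $\lceil (N+1)(1-\alpha)\rceil$-th smallest value among $S_1^{\mathrm{cal}},\dots,S_N^{\mathrm{cal}}$, with the convention $\hat q_{1-\alpha}=+\infty$ if $\lceil (N+1)(1-\alpha)\rceil>N$. One-step prediction set: $\mathcal{C}^{(1)}_{\alpha}(x)=\{\xi\in\mathcal{X}: s_{\hat f}(x,\xi)\le \hat q_{1-\alpha}\}$. *)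

(* Defs.v *)
From HB Require Import structures.
From mathcomp Require Import all_boot all_order all_algebra.
From mathcomp Require Import all_classical all_reals all_analysis.

Set Implicit Arguments.
Unset Strict Implicit.
Unset Printing Implicit Defensive.

Import Order.TTheory GRing.Theory Num.Theory.
Import numFieldNormedType.Exports.

Local Open Scope classical_set_scope.
Local Open Scope ring_scope.

Definition borelRd (R : realType) (d : nat) : Type :=
  g_sigma_algebraType (@open 'rV[R]_d).

HB.instance Definition _ (R : realType) (d : nat) :=
  Measurable.on (borelRd R d).

(* MathComp-Analysis only equips inhabited types with a sigma-algebra, hence
   the proof that X is nonempty in the type. This loses no generality: an empty
   state space carries no probability measure. *)
Definition state (R : realType) (d : nat) (X : set 'rV[R]_d)
  (X_neq0 : X !=set0) : Type := set_type X.

Section state_space.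
Context (R : realType) (d : nat) (X : set 'rV[R]_d) (X_neq0 : X !=set0).

Definition coords (x : state X_neq0) : 'rV[R]_d := set_val x.

HB.instance Definition _ := Choice.copy (state X_neq0) (set_type X).
HB.instance Definition _ := isPointed.Build (state X_neq0)
  (SigSub (mem_set (svalP (cid X_neq0)))).

(* B(X) is the trace on X of the Borel sigma-algebra of R^d. *)
HB.instance Definition _ := Measurable.copy (state X_neq0)
  (g_sigma_algebra_preimageType (coords : state X_neq0 -> borelRd R d)).

End state_space.

Section probability_notions.
Context (d0 : measure_display) (Omega : measurableType d0) (R : realType).
Variable Pr : probability Omega R.

Definition sigma_of d1 (T : measurableType d1) (Y : Omega -> T) :
    set (set Omega) :=
  g_sigma_algebra_preimage Y.

Definition sigma_of_family d1 (T : measurableType d1) (I : Type) (D : set I)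
    (Y : I -> Omega -> T) : set (set Omega) :=
  <<s \bigcup_(i in D) sigma_of (Y i) >>.

Definition has_law d1 (T : measurableType d1) (Y : Omega -> T)
    (mu : probability T R) : Prop :=
  forall A, measurable A -> Pr (Y @^-1` A) = mu A.

(* K is a regular version of the conditional law of Y given G; in all uses K w
   depends on w through a G-measurable variable, so that w |-> K w A is
   G-measurable. *)
Definition has_cond_law (G : set (set Omega)) d1 (T : measurableType d1)
    (Y : Omega -> T) (K : Omega -> set T -> \bar R) : Prop :=
  forall E A, G E -> measurable A ->
    Pr (E `&` Y @^-1` A) = (\int[Pr]_(w in E) K w A)%E.

Definition independent (G H : set (set Omega)) : Prop :=
  forall A B, G A -> H B -> Pr (A `&` B) = (Pr A * Pr B)%E.

Definition mutually_independent (I : finType) (G : I -> set (set Omega)) :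
    Prop :=
  forall (J : {set I}) (A : I -> set Omega),
    (forall i, i \in J -> G i (A i)) ->
    Pr (\bigcap_(i in [set` J]) A i) = (\prod_(i in J) Pr (A i))%E.

Definition identically_distributed d1 (T : measurableType d1) (I : Type)
    (Y : I -> Omega -> T) : Prop :=
  forall i j A, measurable A -> Pr (Y i @^-1` A) = Pr (Y j @^-1` A).

Definition iid d1 (T : measurableType d1) (I : finType) (Y : I -> Omega -> T) :
    Prop :=
  mutually_independent (fun i => sigma_of (Y i)) /\ identically_distributed Y.

Definition markov_chain d1 (T : measurableType d1) (P : R.-pker T ~> T)
    (x : nat -> Omega -> T) : Prop :=
  forall k, has_cond_law (sigma_of_family [set j | (j <= k)%N] x)
    (x k.+1) (fun w => P (x k w)).

End probability_notions.

Definition invariant_measure d1 (T : measurableType d1) (R : realType)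
    (P : R.-pker T ~> T) (mu : probability T R) : Prop :=
  forall A, measurable A -> mu A = (\int[mu]_x P x A)%E.

Section dynamics.
Context (d0 : measure_display) (Omega : measurableType d0) (R : realType).
Context (Pr : probability Omega R).
Context (d : nat) (X : set 'rV[R]_d) (X_neq0 : X !=set0).
Variables (f : state X_neq0 -> state X_neq0).
Variables (x : nat -> Omega -> state X_neq0) (n : nat -> Omega -> borelRd R d).

Definition next_value (k : nat) (w : Omega) : 'rV[R]_d :=
  coords (f (x k w)) + (n k w : 'rV[R]_d).

Definition follows_dynamics : Prop :=
  forall k w, coords (x k.+1 w) = next_value k w.

(* P(z, A) = Pr(f(z) + n_k \in A | x_k = z), in the disintegrated form: for all
   A, B in B(X), Pr(x_k \in B, f(x_k) + n_k \in A) = E[1_(x_k \in B) P(x_k, A)].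
   A is a set of points of the subtype X, hence the image under coords. *)
Definition induced_kernel (P : R.-pker state X_neq0 ~> state X_neq0) : Prop :=
  forall k (A B : set (state X_neq0)), measurable A -> measurable B ->
    Pr (x k @^-1` B `&` next_value k @^-1` (@coords _ _ _ X_neq0 @` A)) =
    (\int[Pr]_(w in x k @^-1` B) P (x k w) A)%E.

End dynamics.

(* For 0 < alpha < 1 the rank is a positive integer, so neither the absolute
   value nor the predecessor truncates. *)
Definition conformal_rank (R : realType) (N : nat) (alpha : R) : nat :=
  `|Num.ceil (N.+1%:R * (1 - alpha))|%N.

Definition conformal_quantile (R : realType) (N : nat) (alpha : R)
    (S : 'I_N -> R) : \bar R :=
  if (conformal_rank N alpha <= N)%N then
    (nth 0 (sort <=%R (codom S)) (conformal_rank N alpha).-1)%:E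
  else +oo%E.

Definition prediction_set (R : realType) (T : Type) (s : T * T -> R)
    (q : \bar R) (x : T) : set T :=
  [set xi | ((s (x, xi))%:E <= q)%E].

(* Main.v *)
(* By invariance of mu and the Markov property, (x_k, x_(k+1)) has the same law
   as each calibration pair, and it is independent of the calibration data, so
   the N + 1 scores are i.i.d. and hence exchangeable. Writing r for the
   conformal rank, S_k <= q holds iff fewer than r scores lie strictly below
   S_k. By exchangeability this event has the same probability for each of the
   N + 1 scores, and at least r of these events always hold simultaneously, so
   the probability is at least r / (N + 1) >= 1 - alpha. *)
Require Import Defs.
From HB Require Import structures.
From mathcomp Require Import all_boot all_order all_algebra perm.
From mathcomp Require Import all_classical all_reals all_analysis. 
From mathcomp Require Import measurable_realfun.

Set Implicit Arguments.
Unset Strict Implicit.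
Unset Printing Implicit Defensive.

Import Order.TTheory GRing.Theory Num.Theory.
Import numFieldNormedType.Exports.

Local Open Scope classical_set_scope.
Local Open Scope ring_scope.

(** * Laws determined by pi-systems: pairs and finite families *)

Lemma eq_law_pi_system (R : realType) d0 (Omega : measurableType d0)
    (Pr : probability Omega R) d (T : measurableType d) (G : set (set T))
    (Y Z : Omega -> T) :
  d.-measurable = <<s G >> -> setI_closed G -> G setT ->
  measurable_fun setT Y -> measurable_fun setT Z ->
  (forall A, G A -> Pr (Y @^-1` A) = Pr (Z @^-1` A)) ->
  forall A, measurable A -> Pr (Y @^-1` A) = Pr (Z @^-1` A).
Proof.
move=> GE GI GT mY mZ YZ A mA.
pose Y' : {mfun Omega >-> T} := HB.pack Y (isMeasurableFun.Build _ _ _ _ Y mY).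
pose Z' : {mfun Omega >-> T} := HB.pack Z (isMeasurableFun.Build _ _ _ _ Z mZ).
(* Pi-lambda uniqueness for the two image laws; the constant sequence [setT] is the cover by members
   of [G] of finite mass. *)
apply: (@g_sigma_algebra_measure_unique _ R _ G _ (fun=> setT) _ _
  (pushforward Pr Y') (pushforward Pr Z')) => //.
- by rewrite GE; exact: sub_sigma_algebra.
- by rewrite bigcup_const.
- by move=> _ /=; rewrite /pushforward preimage_setT probability_setT ltry.
- by rewrite -GE.
Qed.

Lemma eq_law_pair (R : realType) d0 (Omega : measurableType d0)
    (Pr : probability Omega R) d1 d2 (T1 : measurableType d1)
    (T2 : measurableType d2) (Y Z : Omega -> T1 * T2) :
  measurable_fun setT Y -> measurable_fun setT Z ->
  (forall A B, measurable A -> measurable B ->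
     Pr (Y @^-1` (A `*` B)) = Pr (Z @^-1` (A `*` B))) ->
  forall A, measurable A -> Pr (Y @^-1` A) = Pr (Z @^-1` A).
Proof.
move=> mY mZ YZ; apply: eq_law_pi_system mY mZ _.
- exact: measurable_prod_measurableType.
- move=> _ _ [A1 mA1 [B1 mB1 <-]] [A2 mA2 [B2 mB2 <-]].
  by rewrite -setXI; exists (A1 `&` A2); [exact: measurableI|
    exists (B1 `&` B2); [exact: measurableI|]].
- by exists setT => //; exists setT; rewrite ?setXTT.
- by move=> _ [A mA [B mB <-]]; exact: YZ.
Qed.

(** Generates the product sigma-algebra for finite [I]. Full boxes, unlike sets constraining one
    coordinate, are closed under intersection and so form a pi-system directly. *)
Definition boxes d (T : measurableType d) (I : Type) : set (set (I -> T)) :=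
  [set [set y | forall i, A i (y i)] | A in
    [set A : I -> set T | forall i, measurable (A i)]].

Section cylinders.
Context d (T : measurableType d) (I : finType).

Local Notation prodT := (g_sigma_algebraType (@boxes d T I)).

Lemma measurable_coordinate (i : I) :
  measurable_fun setT (fun y : prodT => (y : I -> T) i).
Proof.
move=> _ A mA; rewrite setTI; apply: sub_sigma_algebra.
exists (fun j => if j == i then A else setT); first by move=> j; case: ifP.
apply/seteqP; split=> y /=; first by move/(_ i); rewrite eqxx.
by move=> Ay j; case: eqP => // ->.
Qed.

Lemma measurable_to_cylinders d0 (Omega : measurableType d0)
    (Y : I -> Omega -> T) :
  (forall i, measurable_fun setT (Y i)) ->
  measurable_fun setT (fun w => (Y ^~ w : prodT)).
Proof.
move=> mY; apply: (@measurability _ _ _ prodT _ _ (@boxes d T I)) => // _ [_ [A mA <-] <-].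
rewrite setTI (_ : _ @^-1` _ = \bigcap_(i in setT) (Y i @^-1` A i)); last first.
  by apply/seteqP; split=> w /= h i => [_|]; apply: h.
apply: fin_bigcap_measurable => [|i _]; first exact: finite_finset.
by rewrite -[_ @^-1` _]setTI; exact: mY.
Qed.

Lemma eq_joint_law (R : realType) d0 (Omega : measurableType d0)
    (Pr : probability Omega R) (Y Z : I -> Omega -> T) :
  (forall i, measurable_fun setT (Y i)) ->
  (forall i, measurable_fun setT (Z i)) ->
  (forall A : I -> set T, (forall i, measurable (A i)) ->
     Pr [set w | forall i, A i (Y i w)] = Pr [set w | forall i, A i (Z i w)]) ->
  forall A : set prodT, measurable A ->
    Pr [set w | A (Y ^~ w)] = Pr [set w | A (Z ^~ w)].
Proof.
move=> mY mZ YZ.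
apply: (@eq_law_pi_system _ _ _ Pr _ prodT (@boxes d T I)
  (fun w => Y ^~ w) (fun w => Z ^~ w)) => //.
- move=> _ _ [A mA <-] [B mB <-]; exists (fun i => A i `&` B i).
    by move=> i; exact: measurableI.
  apply/seteqP; split=> y /= => [AB|[Ay By] i]; last by split.
  by split=> i; case: (AB i).
- by exists (fun=> setT) => //; apply/seteqP; split.
- exact: measurable_to_cylinders.
- exact: measurable_to_cylinders.
- by move=> _ [A mA <-]; exact: YZ.
Qed.

End cylinders.

(** * Ranks in a finite family of reals *)

Section rank.
Context (R : realType) (I : finType).
Implicit Types (y : I -> R) (r : nat).

(** With a strict comparison, ties do not raise the rank, so the counting bound below survives
    repeated values. *)
Definition rank_lt r (j : I) y : bool := (#|[pred i | (y i < y j)%R]| < r)%N.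

(** Split over the finitely many candidates [J] for the set of indices below [j]; each is fixed by
    comparisons of two coordinates. *)
Lemma measurable_rank_lt r j :
  measurable ([set y | rank_lt r j y] : set (g_sigma_algebraType (@boxes _ R I))).
Proof.
rewrite (_ : [set _ | _] = \bigcup_(J in [set J : {set I} | (#|J| < r)%N])
    \bigcap_(i in setT) [set y : I -> R | (y i < y j) = (i \in J)]); last first.
  apply/seteqP; split=> y /=.
    move=> yr; exists [set i | y i < y j]%SET => /=.
      by rewrite cardsE.
    by move=> i _ /=; rewrite inE.
  move=> [J /= Jr yJ]; rewrite /rank_lt (_ : #|_| = #|J|)//.
  by apply: eq_card => i; rewrite inE; exact: yJ.
apply: fin_bigcup_measurable => [|J _]; first exact: finite_finset.
apply: fin_bigcap_measurable => [|i _]; first exact: finite_finset.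
have := measurable_fun_ltr (@measurable_coordinate _ R I i)
  (@measurable_coordinate _ R I j).
by move/(_ measurableT [set i \in J]); rewrite setTI; apply.
Qed.

(* Otherwise an index minimising y outside the set would have fewer than r
   values strictly below it, hence belong to the set. *)
Lemma card_rank_lt r y : (r <= #|I| -> r <= #|[pred j | rank_lt r j y]|)%N.
Proof.
move=> rI; rewrite leqNgt; apply/negP => Lr.
have /card_gt0P[j0 j0L] : (0 < #|[predC [pred j | rank_lt r j y]]|)%N.
  by rewrite -(ltn_add2l #|[pred j | rank_lt r j y]|) addn0 cardC (leq_trans Lr).
case: (arg_minP y j0L) => j /negP jL jmin; apply: jL.
rewrite inE /rank_lt; apply: leq_ltn_trans Lr; apply: subset_leq_card.
apply/fintype.subsetP => i; rewrite !inE => yij; apply/negPn/negP => iL.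
by have := jmin i iL; rewrite leNgt yij.
Qed.

End rank.

(** * Exchangeable scores *)

Section exchangeable.
Context (R : realType) d0 (Omega : measurableType d0) (Pr : probability Omega R).
Context (I : finType) (Y : I -> Omega -> R) (nu : set R -> \bar R).
Hypothesis mY : forall i, measurable_fun setT (Y i).
Hypothesis Y_box : forall A : I -> set R, (forall i, measurable (A i)) ->
  Pr [set w | forall i, A i (Y i w)] = (\prod_i nu (A i))%E.

(** The product form in [Y_box] makes the joint law invariant under permutations; the transposition
    of [i] and [j] exchanges their ranks. *)
Lemma prob_rank_lt_eq r i j :
  Pr [set w | rank_lt r i (Y ^~ w)] = Pr [set w | rank_lt r j (Y ^~ w)].
Proof.
pose t := tperm i j; pose Z k w := Y (t k) w.
have -> : [set w | rank_lt r i (Y ^~ w)] = [set w | rank_lt r j (Z ^~ w)].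
  suff h w : rank_lt r i (Y ^~ w) = rank_lt r j (Z ^~ w).
    by apply/seteqP; split=> w /=; rewrite h.
  rewrite /rank_lt -!sum1_card (reindex_inj (@perm_inj _ t)) /=.
  by under [in RHS]eq_bigl do rewrite inE /= /Z tpermR.
apply: (@eq_joint_law _ _ I R _ _ Pr Z Y _ mY _ [set y | rank_lt r j y]).
- by move=> k; exact: mY.
- move=> A mA; rewrite Y_box//.
  rewrite (_ : [set w | _] = [set w | forall k, A (t k) (Y k w)]).
    rewrite [RHS](reindex_inj (@perm_inj _ t)).
    by apply: (Y_box (A := fun k => A (t k))) => k; exact: mA.
  apply/seteqP; split=> w /= h k; last by have := h (t k); rewrite tpermK.
  by have := h (t k); rewrite /Z tpermK.
- exact: measurable_rank_lt.
Qed.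

(** Averaging: the [#|I|] equal probabilities sum to the expectation of a count that is at least [r]
    at every point. *)
Lemma prob_rank_lt_ge r j : (r <= #|I|)%N ->
  ((r%:R / #|I|%:R)%:E <= Pr [set w | rank_lt r j (Y ^~ w)])%E.
Proof.
move=> rI; set p := Pr _.
have I0 : (0 < #|I|)%N by apply/card_gt0P; exists j.
have mE i : measurable [set w | rank_lt r i (Y ^~ w)].
  rewrite -[X in measurable X]setTI.
  exact: (measurable_to_cylinders mY _ (measurable_rank_lt r i)).
have pE : p \is a fin_num by exact: fin_num_measure.
rewrite -(fineK pE) lee_fin ler_pdivrMr ?ltr0n// -lee_fin mulr_natr.
rewrite -sumr_const -sumEFin (eq_bigr (fun i => Pr [set w | rank_lt r i (Y ^~ w)]));
  last by move=> i _; rewrite fineK// /p (prob_rank_lt_eq r j i).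
have -> : (\sum_(i : I) Pr [set w | rank_lt r i (Y ^~ w)] =
    \int[Pr]_w \sum_(i : I) (\1_[set w | rank_lt r i (Y ^~ w)] w)%:E)%E.
  rewrite ge0_integral_sum//; last first.
    by move=> i; apply/measurable_EFinP; exact: measurable_indic.
  by apply: eq_bigr => i _; rewrite integral_indic// setIT.
have -> : r%:R%:E = (\int[Pr]_w (cst r%:R%:E) w)%E.
  by rewrite integral_cst// [X in (_ * X)%E](probability_setT Pr) mule1.
apply: ge0_le_integral => //.
- by move=> w _; rewrite lee_fin.
- by apply: emeasurable_sum => i; apply/measurable_EFinP; exact: measurable_indic.
move=> w _; rewrite sumEFin lee_fin.
apply: (@le_trans _ _ #|[pred i | rank_lt r i (Y ^~ w)]|%:R).
  by rewrite ler_nat; exact: card_rank_lt.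
rewrite -sum1_card natr_sum big_mkcond /= ler_sum// => i _.
by rewrite indicE inE; case: ifP => // h; rewrite mem_set.
Qed.

End exchangeable.

(* The index None stands for the test score z. *)
Lemma le_conformal_quantile (R : realType) (N : nat) (alpha : R) (S : 'I_N -> R)
    (z : R) :
  alpha < 1 -> (conformal_rank N alpha <= N)%N ->
  (z%:E <= conformal_quantile alpha S)%E =
  rank_lt (conformal_rank N alpha) None (oapp S z).
Proof.
move=> a1 rN; rewrite /conformal_quantile rN lee_fin.
set r := conformal_rank N alpha in rN *.
have r0 : (0 < r)%N.
  by rewrite absz_gt0 gt_eqF// ceil_gt0 mulr_gt0 ?subr_gt0.
have -> : rank_lt r None (oapp S z) = (count (< z) (sort <=%R (codom S)) < r)%N.
  rewrite /rank_lt count_sort -sum1_count codomE big_map big_enum_cond -sum1_card.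
  (* [None] is never counted, since [z < z] fails; only the scores [S i] remain. *)
  rewrite (reindex_omap Some id) => [|[i|]]; rewrite ?inE //= ?ltxx//.
  by congr (_ < r)%N; apply: eq_bigl => i; rewrite inE /= eqxx andbT.
have ss : sorted <=%R (sort <=%R (codom S)) by exact: sort_sorted le_total _.
apply/idP/idP => [|cr].
  (* If at least [r] scores lie below [z], the sorted entry of index [r.-1] is one of them. *)
  rewrite leNgt; apply: contraR; rewrite -leqNgt => rc.
  by apply: nth_count_lt => //; rewrite prednK.
apply: nth_count_ge => //; rewrite size_sort size_codom card_ord prednK// rN andbT.
by rewrite -ltnS prednK.
Qed.

(** Isolates the conformal argument from the dynamics: the chain will enter only through the law of
    [W] and its independence from the [Z i]. *)
Lemma split_conformal_coverage (R : realType) d0 (Omega : measurableType d0)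
    (Pr : probability Omega R) d (T : measurableType d) (s : T -> R) (N : nat)
    (alpha : R) (Z : 'I_N -> Omega -> T) (W : Omega -> T) :
  0 < alpha -> alpha < 1 -> measurable_fun setT s ->
  (forall i, measurable_fun setT (Z i)) -> measurable_fun setT W ->
  mutually_independent Pr (fun i => sigma_of (Z i)) ->
  independent Pr (sigma_of_family setT Z) (sigma_of W) ->
  (forall i A, measurable A -> Pr (Z i @^-1` A) = Pr (W @^-1` A)) ->
  ((1 - alpha)%:E <= Pr [set w |
    (s (W w))%:E <= conformal_quantile alpha (fun i => s (Z i w))])%E.
Proof.
move=> a0 a1 ms mZ mW ZI ZW ZE.
have [rN|rN] := leqP (conformal_rank N alpha) N; last first.
  (* The quantile is infinite here, so the event is certain. *)
  rewrite (_ : [set w | _] = setT).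
    by rewrite probability_setT lee_fin lerBlDr lerDl ltW.
  apply/seteqP; split=> w //= _.
  by rewrite /conformal_quantile leqNgt rN leey.
pose Y (o : option 'I_N) w := oapp (fun i => s (Z i w)) (s (W w)) o.
pose nu (A : set R) := Pr (W @^-1` (s @^-1` A)).
have msA A : measurable A -> measurable (s @^-1` A).
  by move=> mA; rewrite -[_ @^-1` _]setTI; exact: ms.
rewrite (_ : [set w | _] =
    [set w | rank_lt (conformal_rank N alpha) None (Y ^~ w)]); last first.
  have YE w : oapp (fun i => s (Z i w)) (s (W w)) = Y ^~ w.
    by apply/funext => -[].
  by apply/seteqP; split=> w /=; rewrite le_conformal_quantile// YE.
(* Rounding up gives [N.+1 * (1 - alpha) <= conformal_rank N alpha], the ceiling being
   nonnegative. *)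
apply: (@le_trans _ _ ((conformal_rank N alpha)%:R / #|{: option 'I_N}|%:R)%:E).
  rewrite lee_fin card_option card_ord ler_pdivlMr ?ltr0n// mulrC.
  rewrite (le_trans (ceil_ge _))// /conformal_rank natr_absz ger0_norm// ceil_ge0.
  by rewrite (lt_le_trans (ltrN10 _))// mulr_ge0// subr_ge0 ltW.
apply: (@prob_rank_lt_ge _ _ _ _ _ _ nu); last first.
- by rewrite card_option card_ord leqW.
- move=> A mA; pose B i := Z i @^-1` (s @^-1` A (Some i)).
  have -> : [set w | forall o, A o (Y o w)] =
      \bigcap_(i in [set` [set: 'I_N]%SET]) B i `&` W @^-1` (s @^-1` A None).
    apply/seteqP; split=> w /= => [h|[h1 h2] [i|]//].
      by split=> [i _|]; [exact: (h (Some i))|exact: (h None)].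
    by apply: h1; rewrite /= inE.
  have sB i : sigma_of (Z i) (B i).
    by exists (s @^-1` A (Some i)); [exact: msA|rewrite setTI].
  (* First [ZW] splits off the test factor, then [ZI] factors the calibration part. *)
  rewrite ZW; last 2 first.
  + apply: (@fin_bigcap_measurable _
      (g_sigma_algebraType (\bigcup_(i in setT) sigma_of (Z i)))) => [|i _].
      exact: finite_finset.
    by apply: sub_sigma_algebra; exists i.
  + by exists (s @^-1` A None); [exact: msA|rewrite setTI].
  rewrite ZI => [|i _]; last exact: sB.
  rewrite [RHS](bigD1 None)//= muleC; congr (_ * _)%E.
  rewrite (reindex_omap Some id) => [|[i|]]//=.
  apply: eq_big => i; first by rewrite inE eqxx.
  by move=> _; apply: ZE; exact: msA.
- by case=> [i|]; exact: measurableT_comp.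
Qed.

(** * Laws along the stationary chain *)

Section laws.
Context (R : realType) d0 (Omega : measurableType d0) (Pr : probability Omega R).
Context d (T : measurableType d) (P : R.-pker T ~> T) (mu : probability T R).

Lemma integral_kernel_law (Y : {RV Pr >-> T}) (A B : set T) :
  has_law Pr Y mu -> measurable A -> measurable B ->
  (\int[Pr]_(w in Y @^-1` A) P (Y w) B = \int[mu]_(y in A) P y B)%E.
Proof.
move=> Ymu mA mB.
have mP : measurable_fun A (P ^~ B).
  by apply: measurable_funTS; exact: measurable_kernel.
rewrite -[LHS](@ge0_integral_pushforward _ _ _ _ _ Y _ Pr A (P ^~ B))//.
by apply: eq_measure_integral => C mC _; exact: Ymu.
Qed.

Lemma joint_law_cond (Y Z : {RV Pr >-> T}) (A B : set T) :
  has_law Pr Y mu -> has_cond_law Pr (sigma_of Y) Z (fun w => P (Y w)) ->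
  measurable A -> measurable B ->
  Pr ((fun w => (Y w, Z w)) @^-1` (A `*` B)) = (\int[mu]_(y in A) P y B)%E.
Proof.
move=> Ymu YZ mA mB; rewrite -(integral_kernel_law Ymu)// -YZ//.
by exists A; rewrite ?setTI.
Qed.

(** Events of the present belong to the past up to [k], and the kernel already depends on [x k]
    alone. *)
Lemma markov_chain_cond (x : nat -> {RV Pr >-> T}) k :
  markov_chain Pr P x ->
  has_cond_law Pr (sigma_of (x k)) (x k.+1) (fun w => P (x k w)).
Proof.
move=> xP E A xE; apply: xP; apply: sub_sigma_algebra.
by exists k => //=.
Qed.

Lemma stationary_law (x : nat -> {RV Pr >-> T}) :
  markov_chain Pr P x -> invariant_measure P mu -> has_law Pr (x 0%N) mu ->
  forall k, has_law Pr (x k) mu.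
Proof.
move=> xP muP x0; elim=> [//|k xk] A mA.
(* Invariance turns [mu A] into the probability that the pair at times [k] and [k.+1] lies in [setT]
   times [A]. *)
rewrite muP// -(joint_law_cond xk (markov_chain_cond (k := k) xP))//.
by congr (Pr _); apply/seteqP; split=> w //= [].
Qed.

End laws.

Theorem theorem1 (R : realType) (d : nat)
  (* Borel state space X of R^d *)
  (X : set 'rV[R]_d) (X_neq0 : X !=set0)
  (X_borel : measurable (X : set (borelRd R d)))
  (* underlying probability space *)
  (d0 : measure_display) (Omega : measurableType d0) (Pr : probability Omega R)
  (* dynamics, noise, trajectory and kernel *)
  (f : state X_neq0 -> state X_neq0)
  (n : nat -> {RV Pr >-> borelRd R d})
  (x : nat -> {RV Pr >-> state X_neq0})
  (P : R.-pker (state X_neq0) ~> (state X_neq0))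
  (x_dyn : follows_dynamics f x n)
  (P_ind : induced_kernel Pr f x n P)
  (x_markov : markov_chain Pr P x)
  (* invariant measure *)
  (mu : probability (state X_neq0) R)
  (mu_inv : invariant_measure P mu)
  (* fixed predictor and score *)
  (fhat : {mfun state X_neq0 >-> state X_neq0})
  (s : (state X_neq0 -> state X_neq0) -> state X_neq0 * state X_neq0 -> R)
  (s_meas : measurable_fun setT (s fhat))
  (s_ge0 : forall z, 0 <= s fhat z)
  (N : nat) (N_ge1 : (1 <= N)%N)
  (alpha : R) (alpha_gt0 : 0 < alpha) (alpha_lt1 : alpha < 1)
  (* initial state and calibration data *)
  (x0_law : has_law Pr (x 0%N) mu)
  (Xcal Xplus : 'I_N -> {RV Pr >-> state X_neq0})
  (Xcal_law : forall i, has_law Pr (Xcal i) mu)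
  (Xplus_law : forall i,
    has_cond_law Pr (sigma_of (Xcal i)) (Xplus i) (fun w => P (Xcal i w)))
  (cal_iid : iid Pr (fun i w => (Xcal i w, Xplus i w)))
  (cal_indep : independent Pr
    (sigma_of_family setT (fun i w => (Xcal i w, Xplus i w)))
    (sigma_of_family setT x))
  (k : nat) :
  let q w := conformal_quantile alpha
    (fun i : 'I_N => s fhat (Xcal i w, Xplus i w)) in
  let Sk w := s fhat (x k w, x k.+1 w) in
  ((1 - alpha)%:E <= Pr [set w | ((Sk w)%:E <= q w)%E])%E /\
  ((1 - alpha)%:E <=
     Pr [set w | prediction_set (s fhat) (q w) (x k w) (x k.+1 w)])%E.
Proof.
move=> q Sk.
suff cov : ((1 - alpha)%:E <= Pr [set w | ((Sk w)%:E <= q w)%E])%E by [].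
have mpair (Y Z : {RV Pr >-> state X_neq0}) :
    measurable_fun setT (fun w => (Y w, Z w)) by exact: measurable_fun_pair.
apply: (split_conformal_coverage alpha_gt0 alpha_lt1 s_meas
  (fun i => mpair (Xcal i) (Xplus i)) (mpair (x k) (x k.+1)) cal_iid.1).
- move=> A B calA [C mC <-]; apply: cal_indep => //.
  (* Equipping [Omega] with the sigma-algebra of the trajectory reduces membership of the event to
     measurability of the pair. *)
  pose F := \bigcup_(j in setT) sigma_of (x j).
  have mx j : measurable_fun setT (x j : g_sigma_algebraType F -> state X_neq0).
    by move=> _ D mD; apply: sub_sigma_algebra; exists j => //; exists D.
  exact: (measurable_fun_pair (mx k) (mx k.+1)).
(* On rectangles, both pairs have the law that integrates [P] against [mu]. *)
- move=> i; apply: eq_law_pair => [||A B mA mB]; [exact: mpair..|].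
  rewrite (joint_law_cond (P := P) (Xcal_law i) (Xplus_law i))//.
  apply/esym/joint_law_cond => //; last exact: markov_chain_cond.
  exact: stationary_law x_markov mu_inv x0_law k.
Qed.
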